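(* For all $n\ge0$ we have $\mathcal{T}_n=\mathcal{S}_n\setminus\mathcal{S}_{n-1}$; that is, the tree defined by counterimages (levels $\mathcal{T}_n$) and that defined by Farey sums (sets $\mathcal{S}_n$) coincide level by level.
   Context: $\overline{\triangle}=\{(x,y)\in\mathbb{R}^2:1\ge x\ge y\ge0\}$, with boundary $\partial\triangle$ and interior $\mathring{\triangle}$. Tree of counterimages. Let $\phi_0(x,y)=\left(\frac{1}{1+y},\frac{x}{1+y}\right)$, $\phi_1(x,y)=\left(\frac{x}{1+y},\frac{y}{1+y}\right)$, $\phi_2(x,x)=(x,0)$. Write $\mathcal{B}_n=\mathcal{T}_n\cap\partial\triangle$, $\mathcal{I}_n=\mathcal{T}_n\cap\mathring{\triangle}$. Set $\mathcal{T}_{-1}=\{(0,0),(1,0),(1,1)\}$, $\mathcal{T}_0=\{(\frac12,0),(1,\frac12),(\frac12,\frac12)\}$. For $n\ge0$ the points of $\mathcal{T}_{n+1}$ are exactly those generated by the rules: (R1) $P\in\mathcal{I}_n$ generates $\phi_0(P),\phi_1(P)\in\mathcal{I}_{n+1}$; (R2) $P\in\mathcal{B}_n\cap\{x=y\}$ generates $\phi_2(P)\in\mathcal{B}_n$ (same level) and $\phi_1(P)\in\mathcal{B}_{n+1}$; (R3) $P\in\mathcal{B}_n\cap\{y=0\}$ generates $\phi_0(P)\in\mathcal{B}_n$ (same level); (R4) $P\in\mathcal{B}_n\cap\{x=1\}$ generates $\phi_0(P)\in\mathcal{B}_{n+1}$ and $\phi_1(P)\in\mathcal{I}_{n+1}$.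 (Same-level parts are applied at every level $n\ge0$.) Mediants and Farey sums. Every rational pair is written $(\frac pq,\frac rq)$ with the two fractions reduced to their least common denominator $q>0$; the mediant is $(\frac pq,\frac rq)\oplus(\frac{p'}{q'},\frac{r'}{q'})=(\frac{p+p'}{q+q'},\frac{r+r'}{q+q'})$. For a finite set $\mathfrak{R}=\{\mathfrak{r}_1,\dots,\mathfrak{r}_r\}$, $r\ge2$, of rational points on a line segment, listed in lexicographic order, its Farey sum is $\mathfrak{R}^\oplus=\{\mathfrak{r}_i\oplus\mathfrak{r}_{i+1}: i=1,\dots,r-1\}\cup\mathfrak{R}$. Partitions. $\mathscr{P}_0=\{\overline{\triangle}\}$, with vertices labelled ''0'', ''1'', ''2'' for $(0,0)$, $(1,0)$, $(1,1)$ respectively. Given $\mathscr{P}_n$ (consisting of $2^n$ labelled triangles), $\mathscr{P}_{n+1}$ is obtained by cutting each triangle of $\mathscr{P}_n$ into two by the line segment joining its vertex ''1'' with the mediant of its vertices ''0'' and ''2''. The new vertex is labelled ''2'' in both subtriangles; in the subtriangle containing the old vertex ''0'' the other two vertices keep their labels ''0'' and ''1''; in the subtriangle containing the old vertex ''2'', this vertex is relabelled ''1'' and the old vertex ''1'' is relabelled ''0''. $\mathscr{S}_0$ is the set of the three sides of $\overline{\triangle}$, and for $n\ge1$ $\mathscr{S}_n$ is obtained from $\mathscr{S}_{n-1}$ by adding the line segments used to cut the triangles of $\mathscr{P}_{n-1}$ to obtain $\mathscr{P}_n$. Tree of Farey sums. $\mathcal{S}_{-1}=\{(0,0),(1,0),(1,1)\}$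 and, for $n\ge-1$, $\mathcal{S}_{n+1}=\bigcup_{\mathfrak{S}\in\mathscr{S}_{n+1}}(\mathfrak{S}\cap\mathcal{S}_n)^\oplus$. *)

(* Defs.v *)
From mathcomp Require Import all_boot all_order all_algebra.
From mathcomp Require Import finmap.
From mathcomp Require Import boolp.

Set Implicit Arguments.
Unset Strict Implicit.
Unset Printing Implicit Defensive.

Import Order.TTheory GRing.Theory Num.Theory.

Local Open Scope fset_scope.
Local Open Scope ring_scope.

(* Every point of both trees is rational, and the segments below have rational
   endpoints, so everything takes place in the rational plane. *)
Definition point : Type := (rat * rat)%type.

Definition in_triangle (P : point) : bool :=
  [&& P.1 <= 1, P.2 <= P.1 & 0 <= P.2].

Definition in_interior (P : point) : bool :=
  [&& P.1 < 1, P.2 < P.1 & 0 < P.2].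

Definition in_boundary (P : point) : bool :=
  in_triangle P && ~~ in_interior P.

Definition triangle_vertices : {fset point} :=
  [fset ((0, 0) : point); ((1, 0) : point); ((1, 1) : point)].

Definition phi0 (P : point) : point := (1 / (1 + P.2), P.1 / (1 + P.2)).
Definition phi1 (P : point) : point := (P.1 / (1 + P.2), P.2 / (1 + P.2)).
(* Meaningful, and only used, on the diagonal x = y. *)
Definition phi2 (P : point) : point := (P.1, 0).

(* Levels are shifted by one so that they start at -1: [calT k] is the level
   T_(k-1) of the tree of counterimages. *)
Inductive calT : nat -> point -> Prop :=
| calT_vertices (P : point) : P \in triangle_vertices -> calT 0 P
| calT_root (P : point) :
    P \in [:: (1 / 2, 0); (1, 1 / 2); (1 / 2, 1 / 2) : point] -> calT 1 P
| calT_R1_phi0 k (P : point) :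
    calT k.+1 P -> in_interior P -> calT k.+2 (phi0 P)
| calT_R1_phi1 k (P : point) :
    calT k.+1 P -> in_interior P -> calT k.+2 (phi1 P)
| calT_R2_phi2 k (P : point) :
    calT k.+1 P -> in_boundary P -> P.1 = P.2 -> calT k.+1 (phi2 P)
| calT_R2_phi1 k (P : point) :
    calT k.+1 P -> in_boundary P -> P.1 = P.2 -> calT k.+2 (phi1 P)
| calT_R3_phi0 k (P : point) :
    calT k.+1 P -> in_boundary P -> P.2 = 0 -> calT k.+1 (phi0 P)
| calT_R4_phi0 k (P : point) :
    calT k.+1 P -> in_boundary P -> P.1 = 1 -> calT k.+2 (phi0 P)
| calT_R4_phi1 k (P : point) :
    calT k.+1 P -> in_boundary P -> P.1 = 1 -> calT k.+2 (phi1 P).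

(* Least common denominator q of the pair; the pair is then (p/q, r/q) with
   p = numq P.1 * (q / denq P.1) and r = numq P.2 * (q / denq P.2). *)
Definition lcd (P : point) : int := lcmz (denq P.1) (denq P.2).
Definition lcd_num1 (P : point) : int := numq P.1 * (lcd P %/ denq P.1)%Z.
Definition lcd_num2 (P : point) : int := numq P.2 * (lcd P %/ denq P.2)%Z.

Definition mediant (P Q : point) : point :=
  ((lcd_num1 P + lcd_num1 Q)%:~R / (lcd P + lcd Q)%:~R,
   (lcd_num2 P + lcd_num2 Q)%:~R / (lcd P + lcd Q)%:~R).

Definition lexle (P Q : point) : bool :=
  ((P : rat *l rat) <= (Q : rat *l rat))%O.

(* The mathematical notion concerns collinear sets with at least two points; on
   smaller sets this returns the set itself. *)
Definition farey_sum (A : {fset point}) : {fset point} :=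
  let s := sort lexle A in
  [fset mediant PQ.1 PQ.2 | PQ in zip s (behead s)] `|` A.

Record ltriangle := LTriangle { vert0 : point; vert1 : point; vert2 : point }.

Definition cut_point (t : ltriangle) : point := mediant (vert0 t) (vert2 t).

Definition subtriangles (t : ltriangle) : seq ltriangle :=
  [:: LTriangle (vert0 t) (vert1 t) (cut_point t);
      LTriangle (vert1 t) (vert2 t) (cut_point t)].

Fixpoint partition_ (n : nat) : seq ltriangle :=
  if n is m.+1 then flatten [seq subtriangles t | t <- partition_ m]
  else [:: LTriangle (0, 0) (1, 0) (1, 1)].

(* A segment is given by its two endpoints. *)
Definition on_segment (s : point * point) (P : point) : Prop :=
  exists t : rat, 0 <= t <= 1 /\
    P = ((1 - t) * s.1.1 + t * s.2.1, (1 - t) * s.1.2 + t * s.2.2).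

Fixpoint segments (n : nat) : seq (point * point) :=
  if n is m.+1 then
    segments m ++ [seq (vert1 t, cut_point t) | t <- partition_ m]
  else
    [:: ((0, 0), (1, 0)); ((1, 0), (1, 1)); ((0, 0), (1, 1))].

(* Same shift as for [calT]: [calS k] is S_(k-1), hence [calS k.+1] is built
   from [calS k] along the segments [segments k]. *)
Fixpoint calS (k : nat) : {fset point} :=
  if k is j.+1 then
    \bigcup_(s <- segments j)
      farey_sum [fset P in calS j | `[< on_segment s P >]]
  else triangle_vertices.

(* Main.v *)
Require Import Defs.
From mathcomp Require Import all_boot all_order all_algebra.
From mathcomp Require Import finmap.
From mathcomp Require Import boolp ring lra.

Local Open Scope fset_scope.

(** The maps [phi0] and [phi1] are projective and unimodular: in homogeneous
    coordinates [(q, p, r)] of [(p/q, r/q)] they act by [(q + r, q, p)] and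
    [(q + r, p, r)], so they commute with mediants and preserve betweenness.
    They send the triangle to the two triangles of the first partition,
    respecting labels, hence every cut of level [n + 1] is the image of a cut of
    level [n] (or of the right side) under one of them.  By induction, a point
    [P] off the bottom side belongs to [S_(n-1)] if and only if its images
    belong to [S_n].  The bottom side is exceptional because [phi1] fixes it
    pointwise and [phi0] maps it to the right side; there one uses instead that
    the sets [S_n] restrict to the same set of parameters on all three sides.
    The generation rules of the tree of counterimages are exactly these two
    facts. *)

Set Implicit Arguments.
Unset Strict Implicit.
Unset Printing Implicit Defensive.

Import Order.TTheory GRing.Theory Num.Theory.
Local Open Scope ring_scope.

(** * Segments, mediants and projective maps *)

Definition seg_pt (s : point * point) (t : rat) : point :=
  ((1 - t) * s.1.1 + t * s.2.1, (1 - t) * s.1.2 + t * s.2.2).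

Lemma seg_pt_comp (s : point * point) (a b t : rat) :
  seg_pt (seg_pt s a, seg_pt s b) t = seg_pt s ((1 - t) * a + t * b).
Proof. by rewrite /seg_pt /=; congr pair; ring. Qed.

Lemma seg_pt0 s : seg_pt s 0 = s.1.
Proof. by case: s => [[a b] [c d]]; rewrite /seg_pt /=; congr pair; ring. Qed.

Lemma seg_pt1 s : seg_pt s 1 = s.2.
Proof. by case: s => [[a b] [c d]]; rewrite /seg_pt /=; congr pair; ring. Qed.

Lemma on_segment_left s : on_segment s s.1.
Proof. by exists 0; split; [lra | rewrite -[LHS](seg_pt0 s)]. Qed.

Lemma on_segment_right s : on_segment s s.2.
Proof. by exists 1; split; [lra | rewrite -[LHS](seg_pt1 s)]. Qed.

Lemma on_segmentC (P Q Z : point) : on_segment (P, Q) Z -> on_segment (Q, P) Z.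
Proof.
case=> t [ht ->]; exists (1 - t); split; first by lra.
by rewrite /=; congr pair; ring.
Qed.

Lemma conv_itv (a b t lo hi : rat) : lo <= a <= hi -> lo <= b <= hi ->
  0 <= t <= 1 -> lo <= (1 - t) * a + t * b <= hi.
Proof. by move=> ha hb ht; nra. Qed.

Lemma on_segment_trans s (P Q Z : point) :
  on_segment s P -> on_segment s Q -> on_segment (P, Q) Z -> on_segment s Z.
Proof.
case=> a [ha ->] [b [hb ->]] [t [ht ->]].
exists ((1 - t) * a + t * b); split; first exact: conv_itv.
exact: seg_pt_comp.
Qed.

Lemma in_triangle_segment (s : point * point) (Z : point) :
  in_triangle s.1 -> in_triangle s.2 -> on_segment s Z -> in_triangle Z.
Proof.
case: s => [[a b] [c d]] /= /and3P[/= h1 h2 h3] /and3P[/= k1 k2 k3] [t [ht ->]].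
by apply/and3P; split=> /=; nra.
Qed.

(* Primitivity of [(q, p, r)] makes [q] the least common denominator. *)
Definition homog (P : point) (q p r : int) : Prop :=
  [/\ 0 < q, P = (p%:~R / q%:~R, r%:~R / q%:~R)
    & forall k : int, (k %| q)%Z -> (k %| p)%Z -> (k %| r)%Z -> (k %| 1)%Z].

Lemma denq_dvd (x : rat) (p q : int) :
  q != 0 -> x = p%:~R / q%:~R -> (denq x %| q)%Z /\ numq x * q = p * denq x.
Proof.
move=> q0 xE.
have e : numq x * q = p * denq x.
  apply/eqP; rewrite -(eqr_int rat) !rmorphM /= numqE xE.
  by apply/eqP; field; rewrite intr_eq0.
split=> //.
have /Gauss_dvdzr <- : coprimez (denq x) (numq x).
  by rewrite coprimez_sym; exact: coprime_num_den.
by rewrite e dvdz_mull.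
Qed.

Lemma lcd_gt0 P : 0 < lcd P.
Proof.
rewrite /lcd; case: P => x y /=.
by rewrite lt_neqAle eq_sym lcmz_neq0 !denq_neq0 /lcmz /=.
Qed.

Lemma dvd_lcd P m : (lcd P %| m)%Z = (denq P.1 %| m)%Z && (denq P.2 %| m)%Z.
Proof. exact: dvdz_lcm. Qed.

Lemma ratioE (x : rat) (l : int) : l != 0 -> (denq x %| l)%Z ->
  x = (numq x * (l %/ denq x)%Z)%:~R / l%:~R.
Proof.
move=> l0 d; rewrite -{1}(divq_num_den x).
have := denq_neq0 x.
case/dvdzP: d l0 => m ->; rewrite mulf_eq0 negb_or => /andP[m0 _] d0.
rewrite mulzK // !rmorphM /=; field.
by rewrite !intr_eq0 d0 m0.
Qed.

(** A common divisor [k] of the triple makes [k * denq x] divide [lcd P] for both coordinates [x],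
    because numerator and denominator are coprime. So [lcd P] divides its own quotient by [k], and
    [k] is a unit. *)
Lemma homog_lcd P : homog P (lcd P) (lcd_num1 P) (lcd_num2 P).
Proof.
have l0 : lcd P != 0 by rewrite gt_eqF // lcd_gt0.
have d1 : (denq P.1 %| lcd P)%Z by exact: dvdz_lcml.
have d2 : (denq P.2 %| lcd P)%Z by exact: dvdz_lcmr.
split; first exact: lcd_gt0.
  by rewrite [LHS]surjective_pairing; congr pair; exact: ratioE.
move=> k; rewrite /lcd_num1 /lcd_num2.
have key (x : rat) : (denq x %| lcd P)%Z -> (k %| lcd P)%Z ->
    (k %| numq x * (lcd P %/ denq x)%Z)%Z -> (k * denq x %| lcd P)%Z.
  case/dvdzP=> m ->; rewrite mulzK ?denq_neq0 // => kq kp.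
  rewrite dvdz_mul //.
  have : (k %| gcdz (m * denq x) (m * numq x))%Z.
    by rewrite dvdz_gcd kq /= [m * numq x]mulrC.
  rewrite -mulz_gcdr gcdzC.
  have /eqP -> : gcdz (numq x) (denq x) == 1 by exact: coprime_num_den.
  by rewrite mulr1 !dvdzE absz_id.
move=> kl /(key _ d1 kl) h1 /(key _ d2 kl) h2.
case/dvdzP: (kl) => m e.
have k0 : k != 0 by apply: contra_neq l0 => k0; rewrite e k0 mulr0.
have lm : (lcd P %| m)%Z.
  by rewrite dvd_lcd -[X in X && _](dvdz_mul2l k0) -[X in _ && X](dvdz_mul2l k0)
    [k * m]mulrC -e h1 h2.
have m0 : m != 0 by apply: contra_neq l0 => m0; rewrite e m0 mul0r.
by rewrite -(dvdz_mul2l m0) mulr1 -e.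
Qed.

(** The triple is an integer multiple of the reduced one; the factor divides all three entries, so
    primitivity forces it to be 1. Mediants can thus be computed from any primitive triple. *)
Lemma homog_unique P q p r : homog P q p r ->
  [/\ lcd P = q, lcd_num1 P = p & lcd_num2 P = r].
Proof.
case=> q0 PE prim.
have q0' : q != 0 by rewrite gt_eqF.
have lgt0 := lcd_gt0 P.
have [d1 n1] := denq_dvd q0' (congr1 fst PE : P.1 = _).
have [d2 n2] := denq_dvd q0' (congr1 snd PE : P.2 = _).
have : (lcd P %| q)%Z by rewrite dvd_lcd d1 d2.
case/dvdzP=> m qE.
have numE (x : rat) (a : int) : (denq x %| lcd P)%Z ->
    numq x * q = a * denq x -> a = m * (numq x * (lcd P %/ denq x)%Z).
  move=> /divzK le; rewrite qE -{1}le => e.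
  apply: (mulIf (denq_neq0 x)); rewrite -e; ring.
have pE : p = m * lcd_num1 P by apply: numE => //; exact: dvdz_lcml.
have rE : r = m * lcd_num2 P by apply: numE => //; exact: dvdz_lcmr.
have m0 : 0 < m by rewrite -(pmulr_lgt0 _ lgt0) -qE.
have m1 : m = 1.
  apply/eqP; rewrite -[m]gtz0_abs // eqz_nat -dvdz1; apply: prim.
  - by rewrite qE dvdz_mulr.
  - by rewrite pE dvdz_mulr.
  - by rewrite rE dvdz_mulr.
by rewrite qE pE rE m1 !mul1r.
Qed.

Lemma mediant_homog P Q q p r q' p' r' : homog P q p r -> homog Q q' p' r' ->
  mediant P Q = ((p + p')%:~R / (q + q')%:~R, (r + r')%:~R / (q + q')%:~R).
Proof.
by move=> /homog_unique[e1 e2 e3] /homog_unique[f1 f2 f3];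
  rewrite /mediant e1 e2 e3 f1 f2 f3.
Qed.

Lemma homog_pos P q p r : homog P q p r -> (0 : rat) < q%:~R.
Proof. by case=> q0 _ _; rewrite ltr0z. Qed.

Lemma mediant_seg P Q : exists2 t : rat, 0 < t < 1 & mediant P Q = seg_pt (P, Q) t.
Proof.
have hP := homog_lcd P; have hQ := homog_lcd Q.
have q0 := homog_pos hP; have q0' := homog_pos hQ.
(* The mediant is the mean of [P] and [Q] with weights [lcd P] and [lcd Q]. *)
exists ((lcd Q)%:~R / (lcd P + lcd Q)%:~R).
  rewrite rmorphD /= divr_gt0 ?addr_gt0 //=.
  by rewrite ltr_pdivrMr ?addr_gt0 // mul1r ltrDr.
rewrite (mediant_homog hP hQ).
case: hP => _ /[dup] /(congr1 fst)/= p1 /(congr1 snd)/= p2 _.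
case: hQ => _ /[dup] /(congr1 fst)/= q1 /(congr1 snd)/= q2 _.
rewrite /seg_pt /= p1 p2 q1 q2 !rmorphD /=.
by congr pair; field; rewrite !gt_eqF ?addr_gt0.
Qed.

Lemma mediant_on_segment P Q : on_segment (P, Q) (mediant P Q).
Proof.
have [t ht ->] := mediant_seg P Q; exists t; split=> //; lra.
Qed.

Lemma mediantC P Q : mediant P Q = mediant Q P.
Proof. by rewrite /mediant addrC (addrC (lcd P)) (addrC (lcd_num2 P)). Qed.

(** * The two projective maps on the triangle *)

Definition phi (b : bool) : point -> point := if b then phi0 else phi1.

Lemma phi_in_triangle b P : in_triangle P -> in_triangle (phi b P).
Proof.
case: P => x y /and3P[/= h1 h2 h3].
have d : 0 < 1 + y by lra.
by case: b; apply/and3P; split=> /=;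
  rewrite ?ler_pdivrMr ?ler_pdivlMr ?divr_ge0 ?mulrVK ?unitfE ?gt_eqF //; lra.
Qed.

Lemma phi_inj b P Q : in_triangle P -> in_triangle Q -> phi b P = phi b Q -> P = Q.
Proof.
case: P Q => x y [x' y'] /and3P[/= h1 h2 h3] /and3P[/= k1 k2 k3].
have d : 1 + y != 0 by rewrite gt_eqF //; lra.
have d' : 1 + y' != 0 by rewrite gt_eqF //; lra.
case: b => -[/eqP]; rewrite eqr_div // => /eqP e1 /eqP;
  rewrite eqr_div // => /eqP e2.
  by congr pair; nra.
by congr pair; nra.
Qed.

(** Primitivity survives because the linear map is unimodular: the missing coordinate is a
    difference of two entries of the image. Nonnegativity of [r] keeps the new denominator
    positive. *)
Lemma homog_phi b P q p r : in_triangle P -> homog P q p r ->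
  homog (phi b P) (q + r) (if b then q else p) (if b then p else r).
Proof.
move=> tP hP; have q0r := homog_pos hP.
case: hP => q0 PE prim.
have r0 : 0 <= r.
  case/and3P: tP => _ _; rewrite PE /= => h.
  by move: h; rewrite pmulr_lge0 ?invr_gt0 // ler0z.
have s0 : 0 < q + r by rewrite ltr_wpDr.
have s0r : (q%:~R + r%:~R : rat) != 0 by rewrite -rmorphD intr_eq0 gt_eqF.
split=> //.
  rewrite PE; case: b; rewrite /phi0 /phi1 /= rmorphD /=; congr pair;
  by rewrite /=; field; rewrite s0r gt_eqF.
move=> k kqr; case: b => h1 h2; apply: prim => //.
  by rewrite (_ : r = q + r - q) ?rpredB //; ring.
by rewrite (_ : q = q + r - r) ?rpredB //; ring.
Qed.

Lemma phi_mediant b P Q : in_triangle P -> in_triangle Q ->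
  phi b (mediant P Q) = mediant (phi b P) (phi b Q).
Proof.
move=> tP tQ.
have := homog_lcd P; have := homog_lcd Q.
move: (lcd P) (lcd_num1 P) (lcd_num2 P) (lcd Q) (lcd_num1 Q) (lcd_num2 Q).
move=> q p r q' p' r' hQ hP.
rewrite (mediant_homog hP hQ).
rewrite (mediant_homog (homog_phi b tP hP) (homog_phi b tQ hQ)).
have := addr_gt0 (homog_pos (homog_phi b tP hP)) (homog_pos (homog_phi b tQ hQ)).
have := addr_gt0 (homog_pos hP) (homog_pos hQ).
rewrite !rmorphD => /lt0r_neq0 d0 /lt0r_neq0 e0.
by case: b; rewrite /phi /phi0 /phi1 /=; congr pair; field; rewrite e0 d0.
Qed.

(* Projective maps act on segment parameters by Moebius transformations. *)
Lemma phi_on_segment b A B Z : in_triangle A -> in_triangle B ->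
  on_segment (A, B) Z -> on_segment (phi b A, phi b B) (phi b Z).
Proof.
case: A B => ax ay [bx c] /and3P[/= a1 a2 a3] /and3P[/= b1 b2 b3] [t [/andP[t0 t1] ->]].
have d1 : 0 < 1 + ay by lra.
have d2 : 0 < 1 + c by lra.
have d : 0 < 1 + ((1 - t) * ay + t * c) by nra.
exists (t * (1 + c) / (1 + ((1 - t) * ay + t * c))); split.
  rewrite divr_ge0 ?mulr_ge0 ?(ltW d) ?(ltW d2) //= ler_pdivrMr //; nra.
have e1 := lt0r_neq0 d1; have e2 := lt0r_neq0 d2; have e := lt0r_neq0 d.
by case: b; congr pair; rewrite /=; field; rewrite e e1 e2.
Qed.

Lemma phi_on_segment_inv b A B Z : in_triangle A -> in_triangle B ->
  on_segment (phi b A, phi b B) Z -> exists2 Y, on_segment (A, B) Y & Z = phi b Y.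
Proof.
case: A B => ax ay [bx c] /and3P[/= a1 a2 a3] /and3P[/= b1 b2 b3] [t [/andP[t0 t1] ->]].
have d1 : 0 < 1 + ay by lra.
have d2 : 0 < 1 + c by lra.
have d : 0 < (1 - t) * (1 + c) + t * (1 + ay) by nra.
have e1 := lt0r_neq0 d1; have e2 := lt0r_neq0 d2; have e := lt0r_neq0 d.
(* This inverts the parameter change of [phi_on_segment]: the weights [1 + ay] and [1 + c] trade
   places. *)
pose u := t * (1 + ay) / ((1 - t) * (1 + c) + t * (1 + ay)).
exists (seg_pt ((ax, ay), (bx, c)) u).
  exists u; split=> //.
  rewrite divr_ge0 ?mulr_ge0 ?(ltW d) ?(ltW d1) //= ler_pdivrMr //; nra.
have g : 1 + ((1 - u) * ay + u * c) =
    (1 + ay) * (1 + c) / ((1 - t) * (1 + c) + t * (1 + ay)).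
  by rewrite /u; field.
by case: b; congr pair; rewrite /= g /u; field; rewrite e e1 e2.
Qed.

(** * Farey sums *)

(** Describes consecutive entries by the order alone, so that lists disappear from the treatment of
    Farey sums. *)
Lemma mem_zip_behead {T : eqType} (s : seq T) (r : rel T) (x y : T) :
  irreflexive r -> transitive r -> sorted r s ->
  ((x, y) \in zip s (behead s)) <->
  [/\ x \in s, y \in s, r x y & forall z, z \in s -> ~~ (r x z && r z y)].
Proof.
move=> irr tr.
elim: s => [|a [|b s] IH]; [by split=> // -[]| |].
  by split=> // -[]; rewrite !inE => /eqP-> /eqP->; rewrite irr.
move=> srt; have {}IH := IH (path_sorted srt).
have asym u v : r u v -> ~~ r v u.
  by move=> uv; apply/negP => /(tr _ _ _ uv); rewrite irr.
have /allP a_lt : all (r a) (b :: s) by exact: order_path_min.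
have /allP b_lt : all (r b) s by case/andP: srt => _; exact: order_path_min.
rewrite [zip _ _]/= [(x, y) \in _]in_cons; split.
  case/orP=> [/eqP[-> ->]|/IH[xs ys xy between]].
    split; rewrite ?inE ?eqxx ?orbT ?a_lt ?inE ?eqxx //.
    move=> z /predU1P[->|/predU1P[->|/b_lt/asym/negPf->]]; by rewrite ?irr ?andbF.
  split=> //; [by rewrite in_cons xs orbT | by rewrite in_cons ys orbT |].
  by move=> z /predU1P[->|/between//]; rewrite (negPf (asym _ _ (a_lt _ xs))).
case=> /predU1P[->|xs] /predU1P[->|ys] xy between.
- by rewrite irr in xy.
- case/predU1P: ys xy between => [->|ys] xy between; first by rewrite eqxx.
  have /between : b \in [:: a, b & s] by rewrite !inE eqxx orbT.
  by rewrite a_lt ?inE ?eqxx // b_lt.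
- by rewrite (negPf (asym _ _ (a_lt _ xs))) in xy.
- apply/orP; right; apply/IH; split=> // z zs.
  by apply: between; rewrite in_cons zs orbT.
Qed.

Lemma lexltE (P Q : point) :
  ((P : rat *l rat) < (Q : rat *l rat))%O =
  (P.1 <= Q.1) && ((Q.1 <= P.1) ==> (P.2 < Q.2)).
Proof. by case: P Q => a b [c d]. Qed.

(** Along a segment the lexicographic order is the order of the parameter or its reverse. The first
    coordinate decides which, or the second one if the segment is vertical. *)
Lemma lexlt_between s (P Q Z : point) :
  on_segment s P -> on_segment s Q -> on_segment s Z ->
  ((P : rat *l rat) < (Z : rat *l rat))%O ->
  ((Z : rat *l rat) < (Q : rat *l rat))%O -> on_segment (P, Q) Z.
Proof.
case: s => [[a b] [c d]] [t [ht ->]] [u [hu ->]] [v [hv ->]] /=.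
rewrite !lexltE /= => /andP[h1 h2] /andP[k1 k2].
case: (eqVneq t u) => [tu|tu].
  by subst u; exfalso; have := le_anti (introT andP (conj h1 k1)) => e;
    rewrite e lexx /= in h2 k2; have := lt_trans h2 k2; rewrite ltxx.
exists ((v - t) / (u - t)).
have ut : u - t != 0 by rewrite subr_eq0 eq_sym.
split; last by congr pair; rewrite /=; field; exact: ut.
case: (ltgtP a c) => ac.
- have tv : t <= v by nra.
  have vu : v <= u by nra.
  have u0 : 0 < u - t by lra.
  by rewrite divr_ge0 ?ler_pdivrMr //; lra.
- have tv : v <= t by nra.
  have vu : u <= v by nra.
  have u0 : 0 < t - u by lra.
  rewrite -mulrNN -invrN !opprB.
  by rewrite divr_ge0 ?ler_pdivrMr //; lra.
subst c.
have e x : (1 - x) * a + x * a = a by ring.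
rewrite !e lexx /= in h2 k2.
case: (ltP b d) => bd.
- have tv : t <= v by nra.
  have vu : v <= u by nra.
  have u0 : 0 < u - t by lra.
  by rewrite divr_ge0 ?ler_pdivrMr //; lra.
- have tv : v <= t by nra.
  have vu : u <= v by nra.
  have u0 : 0 < t - u by lra.
  rewrite -mulrNN -invrN !opprB.
  by rewrite divr_ge0 ?ler_pdivrMr //; lra.
Qed.

Lemma between_lexlt (P Q Z : point) : ((P : rat *l rat) < (Q : rat *l rat))%O ->
  on_segment (P, Q) Z -> Z <> P -> Z <> Q ->
  ((P : rat *l rat) < (Z : rat *l rat))%O && ((Z : rat *l rat) < (Q : rat *l rat))%O.
Proof.
move=> PQ [t [ht ZE]] ZP ZQ.
have t0 : t != 0 by apply/eqP => t0; apply: ZP; rewrite ZE t0; exact: (seg_pt0 (P, Q)).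
have t1 : t != 1 by apply/eqP => t1; apply: ZQ; rewrite ZE t1; exact: (seg_pt1 (P, Q)).
have {t0 t1}ht : 0 < t < 1 by rewrite !lt_neqAle eq_sym t0 t1.
rewrite {ZP ZQ}ZE; move: PQ; rewrite !lexltE.
case: P Q => a b [c d] /= /andP[ac /implyP bd].
case: (ltP a c) => [{bd}ac|/[dup] ca /bd {}bd].
  have k1 : a < (1 - t) * a + t * c by nra.
  have k2 : (1 - t) * a + t * c < c by nra.
  by rewrite (ltW k1) (ltW k2) !leNgt k1 k2.
have {ca}e : a = c by apply/le_anti/andP.
subst c; have -> : (1 - t) * a + t * a = a by ring.
by rewrite lexx /=; apply/andP; split; nra.
Qed.

(* Consecutive elements, up to order: betweenness replaces the lexicographic
   order because projective maps may reverse the latter. *)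
Definition adj (X : {fset point}) (P Q : point) : Prop :=
  [/\ P \in X, Q \in X, P <> Q
    & forall Z, Z \in X -> on_segment (P, Q) Z -> Z = P \/ Z = Q].

Lemma adjC X P Q : adj X P Q -> adj X Q P.
Proof.
case=> PX QX PQ h; split=> // [/esym//|Z ZX /on_segmentC/(h Z ZX)[]]; by [left|right].
Qed.

(** Adjacency may be taken in all of [X] instead of its trace on [s]: segments are convex, so a
    point of [X] between two points of [s] already lies on [s]. *)
Lemma farey_sumP (X : {fset point}) s (P : point) :
  P \in farey_sum [fset Q in X | `[< on_segment s Q >]] <->
  (P \in X /\ on_segment s P) \/
  exists Q R, [/\ adj X Q R, on_segment s Q, on_segment s R & P = mediant Q R].
Proof.
set A := [fset Q in X | _].
have inA Q : (Q \in A) <-> Q \in X /\ on_segment s Q.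
  by rewrite !inE; split=> [/andP[-> /asboolP]|[-> /asboolP]].
pose lt (P Q : point) := ((P : rat *l rat) < (Q : rat *l rat))%O.
have irr : irreflexive lt by move=> x; exact: ltxx.
have tr : transitive lt by move=> y x z; exact: lt_trans.
have srt : sorted lt (sort lexle A).
  by rewrite (@sort_lt_sorted _ (rat *l rat)%type); exact: fset_uniq.
have zipP Q R := @mem_zip_behead _ _ _ Q R irr tr srt.
have memA Q : (Q \in sort lexle A) = (Q \in A) by rewrite mem_sort.
rewrite /farey_sum inE; split.
  case/orP=> [/imfsetP[[Q R] /= /zipP[]]|/inA]; last by left.
  rewrite !memA => /inA[QX sQ] /inA[RX sR] QR h ->; right; exists Q, R; split=> //.
  split=> // [e|Z ZX QRZ]; first by rewrite e irr in QR.
  have ZA : Z \in sort lexle A.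
    by rewrite memA; apply/inA; split=> //; exact: on_segment_trans QRZ.
  case: (eqVneq Z Q) => [->|/eqP ZQ]; first by left.
  case: (eqVneq Z R) => [->|/eqP ZR]; first by right.
  by have := h Z ZA; rewrite /lt between_lexlt.
case=> [/inA->|[Q [R [QR sQ sR ->]]]]; first by rewrite orbT.
wlog lQR : Q R QR sQ sR / lt Q R => [wlg|].
  case: (ltgtP (Q : rat *l rat) (R : rat *l rat)) => [|l|].
  - exact: wlg.
  - by rewrite mediantC; apply: wlg => //; exact: adjC.
  - by case: QR.
apply/orP; left; apply/imfsetP; exists (Q, R) => //=.
case: QR => QX RX QR h; apply/zipP; split; rewrite ?memA //; try exact/inA.
move=> Z; rewrite memA => /inA[ZX sZ]; apply/negP => /andP[QZ ZR].
have [] := h Z ZX (lexlt_between sQ sR sZ QZ ZR) => e.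
  by rewrite e irr in QZ.
by rewrite e irr in ZR.
Qed.

Lemma calSS k (P : point) : P \in calS k.+1 <->
  exists2 s, s \in segments k & (P \in calS k /\ on_segment s P) \/
  exists Q R, [/\ adj (calS k) Q R, on_segment s Q, on_segment s R & P = mediant Q R].
Proof.
rewrite /=; split.
  by case/bigfcupP=> s; rewrite andbT => sk /farey_sumP h; exists s.
by case=> s sk /farey_sumP h; apply/bigfcupP; exists s => //; rewrite sk.
Qed.

(** * Segments of the partitions *)

(* The relative interior of the bottom side is left out because there [phi0] and
   [phi1] do not raise the level. *)
Definition good (P : point) : bool :=
  in_triangle P && [|| 0 < P.2, P.1 == 0 | P.1 == 1].

(** Such a segment meets the bottom side at most in one endpoint, which is then a corner. *)
Definition upper (s : point * point) : bool :=
  [&& good s.1, good s.2 & (0 < s.1.2) || (0 < s.2.2)].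

Definition seg_map b (s : point * point) := (phi b s.1, phi b s.2).

Lemma good_in_triangle P : good P -> in_triangle P.
Proof. by case/andP. Qed.

Lemma phi_pos b P : in_triangle P -> 0 < P.2 -> 0 < (phi b P).2.
Proof.
case: P => x y /and3P[/= h1 h2 h3] y0.
by case: b; rewrite /= divr_gt0 //; lra.
Qed.

Lemma good_phi b P : good P -> good (phi b P).
Proof.
move=> /andP[tP gP]; rewrite /good phi_in_triangle //=.
case/or3P: gP => [/(phi_pos b tP)-> //| |].
- case: P tP => x y /and3P[/= h1 h2 h3] /eqP x0.
  have y0 : y = 0 by lra.
  by rewrite x0 y0; case: b.
- case: P tP => x y /and3P[/= h1 h2 h3] /eqP ->.
  case: (ltP 0 y) => [y0|y0]; first by
    rewrite (phi_pos b (P := (1, y))) //; apply/and3P; split=> /=; lra.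
  have -> : y = 0 by lra.
  by case: b.
Qed.

Lemma upper_seg_map b s : upper s -> upper (seg_map b s).
Proof.
case/and3P => g1 g2 h; rewrite /upper /= !good_phi //=.
by case/orP: h => /(phi_pos b) ->; rewrite ?orbT // good_in_triangle.
Qed.

Lemma upper_good s P : upper s -> on_segment s P -> good P.
Proof.
case: s => A B /and3P[/= gA gB h] sP.
have tP := in_triangle_segment (s := (A, B)) (good_in_triangle gA) (good_in_triangle gB) sP.
rewrite /good tP /=; case: sP => t [ht PE].
case: (eqVneq t 0) PE => [->|t0 PE].
  by rewrite (_ : (_, _) = A) => [->|]; [case/andP: gA | exact: (seg_pt0 (A, B))].
case: (eqVneq t 1) PE => [->|t1 PE].
  by rewrite (_ : (_, _) = B) => [->|]; [case/andP: gB | exact: (seg_pt1 (A, B))].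
have {t0 t1}ht' : 0 < t < 1 by rewrite !lt_neqAle eq_sym t0 t1.
case/andP: gA => /and3P[a1 a2 a3] _; case/andP: gB => /and3P[b1 b2 b3] _.
suff -> : 0 < P.2 by [].
by rewrite PE /=; case/orP: h => h; nra.
Qed.

(** Height is affine along [s]: if it vanished at two distinct points, it would vanish at both
    ends. *)
Lemma upper_sub s P Q : upper s -> on_segment s P -> on_segment s Q -> P <> Q ->
  upper (P, Q).
Proof.
move=> us sP sQ PQ.
rewrite /upper /= (upper_good us sP) (upper_good us sQ) /=.
have /and3P[_ _ p2] := good_in_triangle (upper_good us sP).
have /and3P[_ _ q2] := good_in_triangle (upper_good us sQ).
rewrite !lt_neqAle p2 q2 !andbT -negb_and ![0 == _]eq_sym.
apply/negP => /andP[/eqP p0 /eqP q0].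
case: s us sP sQ => A B /and3P[/= gA gB h] [t [ht PE]] [u [hu QE]].
have tu : t != u by apply/eqP => tu; apply: PQ; rewrite PE QE tu.
have /and3P[_ _ a2] := good_in_triangle gA.
have /and3P[_ _ b2] := good_in_triangle gB.
rewrite PE /= in p0; rewrite QE /= in q0.
have e : (t - u) * (A.2 - B.2) = 0 by lra.
move/eqP: e; rewrite mulf_eq0 !subr_eq0 (negPf tu) /= => /eqP e.
have b0 : B.2 = 0 by rewrite e in p0; lra.
by move: h; rewrite e b0 ltxx.
Qed.

Lemma upper_in_triangle s : upper s -> in_triangle s.1 /\ in_triangle s.2.
Proof. by case/and3P => /good_in_triangle ? /good_in_triangle ?. Qed.

(** * Labelled triangles and cuts under the two maps *)

Definition tri_map b t :=
  LTriangle (phi b (vert0 t)) (phi b (vert1 t)) (phi b (vert2 t)).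

Definition tri_in t :=
  [&& in_triangle (vert0 t), in_triangle (vert1 t) & in_triangle (vert2 t)].

Lemma mediant_in_triangle P Q : in_triangle P -> in_triangle Q ->
  in_triangle (mediant P Q).
Proof.
by move=> tP tQ; apply: (in_triangle_segment (s := (P, Q))) => //;
  exact: mediant_on_segment.
Qed.

Lemma partition_in n : all tri_in (partition_ n).
Proof.
elim: n => [|n] //=; elim: (partition_ n) => //= t l IH /andP[/and3P[h0 h1 h2] /IH ->].
by rewrite /tri_in /= h0 h1 h2 !mediant_in_triangle.
Qed.

(** The recursion refines at the leaves; here the first cut is made at the root instead. The two
    first subtriangles are the images of the whole triangle with matching labels, and cutting
    commutes with [phi] because mediants do. *)
Lemma partitionS n : partition_ n.+1 =
  map (tri_map false) (partition_ n) ++ map (tri_map true) (partition_ n).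
Proof.
have key b l : all tri_in l ->
    flatten [seq subtriangles t | t <- map (tri_map b) l] =
    map (tri_map b) (flatten [seq subtriangles t | t <- l]).
  elim: l => //= t l IH /andP[/and3P[h0 h1 h2] /IH ->].
  by rewrite /tri_map /cut_point /= phi_mediant.
elim: n => [|n IH].
  have m : mediant (0, 0) (1, 1) = (1 / 2, 1 / 2) by apply/eqP; vm_compute.
  rewrite /= /subtriangles /cut_point /= m /tri_map /=.
  by congr [:: LTriangle _ _ _; LTriangle _ _ _]; apply/eqP; vm_compute.
have all_in := partition_in n.
rewrite [LHS]/= -/(partition_ n.+1) {1}IH map_cat flatten_cat !key //.
Qed.

Definition cut_seg t := (vert1 t, cut_point t).

Lemma cut_segsS n : map cut_seg (partition_ n.+1) =
  map (seg_map false) (map cut_seg (partition_ n)) ++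
  map (seg_map true) (map cut_seg (partition_ n)).
Proof.
rewrite partitionS map_cat.
have key b l : all tri_in l ->
    map cut_seg (map (tri_map b) l) = map (seg_map b) (map cut_seg l).
  elim: l => //= t l IH /andP[/and3P[h0 h1 h2] /IH ->].
  by rewrite /cut_seg /seg_map /cut_point /= phi_mediant.
by rewrite !key // partition_in.
Qed.

Definition bottom : point * point := ((0, 0), (1, 0)).
Definition right_side : point * point := ((1, 0), (1, 1)).
Definition diag : point * point := ((0, 0), (1, 1)).

(** The only cut that has to be obtained from a side rather than from an earlier cut. *)
Lemma cut_segs0 : map cut_seg (partition_ 0) = [:: seg_map false right_side].
Proof. by apply/eqP; vm_compute. Qed.

Lemma upper_right_side : upper right_side. Proof. by vm_compute. Qed.
Lemma upper_diag : upper diag. Proof. by vm_compute. Qed.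

Lemma upper_cut_segs n : all upper (map cut_seg (partition_ n)).
Proof.
elim: n => [|n IH].
  by rewrite cut_segs0 all_seq1; exact: upper_seg_map upper_right_side.
rewrite cut_segsS all_cat; apply/andP; split; apply/allP => s /mapP[s' hs' ->];
  exact/upper_seg_map/(allP IH).
Qed.

Lemma segmentsS k : segments k.+1 = segments k ++ map cut_seg (partition_ k).
Proof. by []. Qed.

Lemma segments_sub k : {subset segments k <= segments k.+1}.
Proof. by move=> s sk; rewrite segmentsS mem_cat sk. Qed.

Lemma sides_sub k : {subset segments 0 <= segments k}.
Proof. by elim: k => // k IH s /IH; exact: segments_sub. Qed.

(** A segment other than a side is a cut of some partition, and its image is a cut of the next
    one. *)
Lemma segments_phi k b s : s \in segments k ->
  s \in segments 0 \/ seg_map b s \in segments k.+1.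
Proof.
elim: k => [|k IH]; first by left.
rewrite segmentsS mem_cat; case/orP => [/IH[|sk]|sk]; [by left|right|right].
  exact: segments_sub.
rewrite segmentsS mem_cat; apply/orP; right.
clear IH; rewrite cut_segsS mem_cat; apply/orP.
by case: b; [right|left]; exact: map_f.
Qed.

Lemma segments_upper k s : s \in segments k -> s = bottom \/ upper s.
Proof.
elim: k => [|k IH].
  rewrite !inE => /or3P[]/eqP->; [by left| |]; right.
    exact: upper_right_side.
  exact: upper_diag.
rewrite segmentsS mem_cat => /orP[/IH//|sk]; right.
exact: (allP (upper_cut_segs k)).
Qed.

Lemma segments_inv k s : s \in segments k.+1 ->
  s \in segments 0 \/
  exists b s', [/\ s = seg_map b s', s' \in segments k & upper s'].
Proof.
elim: k s => [|k IH] s; rewrite segmentsS mem_cat => /orP[].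
- by left.
- rewrite cut_segs0 inE => /eqP->.
  right; exists false, right_side; split=> //; exact: upper_right_side.
- case/IH=> [|[b [s' [-> sk us]]]]; [by left|right].
  by exists b, s'; split=> //; exact: segments_sub.
rewrite cut_segsS mem_cat => /orP[] /mapP[s' sk ->]; right;
  [exists false|exists true]; exists s'; split=> //.
- by rewrite segmentsS mem_cat sk orbT.
- exact: (allP (upper_cut_segs k)).
- by rewrite segmentsS mem_cat sk orbT.
- exact: (allP (upper_cut_segs k)).
Qed.

(** * Farey sums on the sides *)

Lemma segments_in_triangle k s P : s \in segments k -> on_segment s P -> in_triangle P.
Proof.
case/segments_upper => [->|/upper_in_triangle[h1 h2]]; exact: in_triangle_segment.
Qed.

Lemma calS_on_segment k P : P \in calS k ->
  exists2 s, s \in segments k & on_segment s P.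
Proof.
case: k => [|k].
  rewrite !inE => /orP[/orP[]|] /eqP->.
  - by exists bottom => //; exact: (on_segment_left bottom).
  - by exists bottom => //; exact: (on_segment_right bottom).
  - by exists diag => //; exact: (on_segment_right diag).
case/calSS => s /segments_sub sk h; exists s => //.
case: h => [[]//|[Q [R [_ sQ sR ->]]]].
exact/(on_segment_trans sQ sR)/mediant_on_segment.
Qed.

Lemma calS_in_triangle k P : P \in calS k -> in_triangle P.
Proof. by case/calS_on_segment => s; exact: segments_in_triangle. Qed.

(** A union of Farey sums keeps only points that lie on some segment, so monotonicity rests on
    [calS_on_segment]. *)
Lemma calS_sub k : {subset calS k <= calS k.+1}.
Proof.
move=> P Pk; have [s sk sP] := calS_on_segment Pk.
by apply/calSS; exists s => //; left.
Qed.

Lemma corner_calS k P : P \in calS 0 -> P \in calS k.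
Proof. by elim: k => // k IH /IH; exact: calS_sub. Qed.

Lemma calS_mediant k s Q R : s \in segments k -> adj (calS k) Q R ->
  on_segment s Q -> on_segment s R -> mediant Q R \in calS k.+1.
Proof. by move=> sk a sQ sR; apply/calSS; exists s => //; right; exists Q, R. Qed.

Lemma calS_cases k P : P \in calS k.+1 -> P \in calS k \/
  exists s Q R, [/\ s \in segments k, adj (calS k) Q R, on_segment s Q,
                    on_segment s R & P = mediant Q R].
Proof.
case/calSS => s sk [[Pk _]|[Q [R [a sQ sR ->]]]]; first by left.
by right; exists s, Q, R.
Qed.

(** A side is a face: one inequality defining the triangle is an equality there, and equality
    strictly between [P] and [Q] forces it at both. *)
Lemma side_face s P Q t x : s \in segments 0 -> in_triangle P -> in_triangle Q ->
  0 < t < 1 -> seg_pt (P, Q) t = seg_pt s x ->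
  (exists2 a, 0 <= a <= 1 & P = seg_pt s a) /\
  (exists2 a, 0 <= a <= 1 & Q = seg_pt s a).
Proof.
case: P Q => a b [c d] s0 /and3P[/= p1 p2 p3] /and3P[/= q1 q2 q3] ht.
move: s0; rewrite !inE => /or3P[]/eqP-> [] /= e1 e2.
- have b0 : b = 0 by nra.
  have d0 : d = 0 by nra.
  split; [exists a; [lra|]|exists c; [lra|]]; rewrite ?b0 ?d0 /seg_pt /=; congr pair; ring.
- have a1 : a = 1 by nra.
  have c1 : c = 1 by nra.
  split; [exists b; [lra|]|exists d; [lra|]]; rewrite ?a1 ?c1 /seg_pt /=; congr pair; ring.
- have ab : a = b by nra.
  have cd : c = d by nra.
  split; [exists b; [lra|]|exists d; [lra|]]; rewrite ?ab ?cd /seg_pt /=; congr pair; ring.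
Qed.

(** For a reduced fraction [p/q] the point with that parameter has the primitive triple [(q, p, 0)],
    [(q, q, p)] or [(q, p, p)], depending on the side. So mediants on a side are those of the
    parameters. *)
Lemma mediant_side s a b : s \in segments 0 -> mediant (seg_pt s a) (seg_pt s b) =
  seg_pt s ((numq a + numq b)%:~R / (denq a + denq b)%:~R).
Proof.
have prim (x : rat) (k : int) : (k %| denq x)%Z -> (k %| numq x)%Z -> (k %| 1)%Z.
  move=> kd kn; have : (k %| gcdz (numq x) (denq x))%Z by rewrite dvdz_gcd kn kd.
  by have /eqP -> : gcdz (numq x) (denq x) == 1 by exact: coprime_num_den.
have ratE (x : rat) : x = (numq x)%:~R / (denq x)%:~R by rewrite divq_num_den.
have d0 (x : rat) : (denq x)%:~R != 0 :> rat by rewrite intr_eq0 denq_neq0.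
have dd : (denq a + denq b)%:~R != 0 :> rat.
  by rewrite intr_eq0 gt_eqF // addr_gt0.
rewrite !inE => /or3P[]/eqP->.
- have h x : homog (seg_pt ((0, 0), (1, 0)) x) (denq x) (numq x) 0.
    split=> [||k kd kn _]; [exact: denq_gt0| |exact: prim kn].
    rewrite [in LHS](ratE x) /seg_pt /=; by congr pair; field; rewrite ?d0.
  by rewrite (mediant_homog (h a) (h b)) /seg_pt /=; congr pair; field; rewrite -?rmorphD ?dd.
- have h x : homog (seg_pt ((1, 0), (1, 1)) x) (denq x) (denq x) (numq x).
    split=> [||k kd _ kn]; [exact: denq_gt0| |exact: prim kn].
    rewrite [in LHS](ratE x) /seg_pt /=; by congr pair; field; rewrite ?d0.
  by rewrite (mediant_homog (h a) (h b)) /seg_pt /=; congr pair; field; rewrite -?rmorphD ?dd.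
- have h x : homog (seg_pt ((0, 0), (1, 1)) x) (denq x) (numq x) (numq x).
    split=> [||k kd kn _]; [exact: denq_gt0| |exact: prim kn].
    rewrite [in LHS](ratE x) /seg_pt /=; by congr pair; field; rewrite ?d0.
  by rewrite (mediant_homog (h a) (h b)) /seg_pt /=; congr pair; field; rewrite -?rmorphD ?dd.
Qed.

Lemma seg_pt_side_inj s : s \in segments 0 -> injective (seg_pt s).
Proof.
by rewrite !inE => /or3P[]/eqP-> x y [] /= e1 e2; lra.
Qed.

Lemma seg_pt_on_segment s a b z : s \in segments 0 ->
  on_segment (seg_pt s a, seg_pt s b) (seg_pt s z) <->
  exists2 t : rat, 0 <= t <= 1 & z = (1 - t) * a + t * b.
Proof.
move=> s0; split=> [[t [ht e]]|[t ht ->]]; exists t => //.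
  by apply: (seg_pt_side_inj s0); rewrite e -seg_pt_comp.
by split=> //; rewrite -[LHS]seg_pt_comp.
Qed.

(** Both mediants and betweenness on a side depend only on parameters, so an adjacent pair on one
    side transfers to any other. *)
Lemma calS_side k s s' x : s \in segments 0 -> s' \in segments 0 ->
  seg_pt s x \in calS k -> seg_pt s' x \in calS k.
Proof.
elim: k s s' x => [|k IH] s s' x s0 s0'.
  move=> h; have {h} : x = 0 \/ x = 1.
    by move: s0 h; rewrite !inE => /or3P[]/eqP-> /orP[/orP[]|] /eqP[] /= e1 e2;
      (left; lra) || (right; lra).
  by move: s0'; rewrite !inE => /or3P[]/eqP-> [] ->;
    rewrite ?seg_pt0 ?seg_pt1 /= ?eqxx ?orbT.
case/calS_cases => [/(IH _ _ _ s0 s0')/calS_sub//|[u [Q [R [uk aQR uQ uR e]]]]].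
have tQ := segments_in_triangle uk uQ.
have tR := segments_in_triangle uk uR.
have [t ht et] := mediant_seg Q R; rewrite et in e.
(* The pair was found on some segment [u], possibly not [s]; the face property places it on [s]. *)
have [[a ha Qa] [b hb Rb]] := side_face s0 tQ tR ht (esym e).
subst Q R; rewrite -et mediant_side // in e; move/(seg_pt_side_inj s0): e => ->.
rewrite -mediant_side //; apply: (calS_mediant (sides_sub k s0')); last 2 first.
- by exists a.
- by exists b.
case: aQR => aX bX ab h; split.
- exact: IH aX.
- exact: IH bX.
- by move=> /(seg_pt_side_inj s0') e; apply: ab; rewrite e.
move=> Z ZX [v [hv e]]; have {}e := etrans e (seg_pt_comp s' a b v); subst Z.
have /h [] : seg_pt s ((1 - v) * a + v * b) \in calS k by exact: IH ZX.
- by apply/seg_pt_on_segment => //; exists v.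
- by move/(seg_pt_side_inj s0) ->; left.
- by move/(seg_pt_side_inj s0) ->; right.
Qed.

(** * Self-similarity of the Farey sums *)

(** Every point between [Q] and [R] is [good], so the assumed equivalence also covers the points
    that could separate the pair. *)
Lemma adj_phi (X X' : {fset point}) b Q R :
  (forall P, good P -> (phi b P \in X') = (P \in X)) -> upper (Q, R) ->
  adj X' (phi b Q) (phi b R) <-> adj X Q R.
Proof.
move=> XX' uQR; have [/= tQ tR] := upper_in_triangle uQR.
have /and3P[/= gQ gR _] := uQR.
split=> -[QX RX QR h]; split.
- by rewrite -XX'.
- by rewrite -XX'.
- by move=> e; apply: QR; rewrite e.
- move=> Z ZX sZ; have gZ := upper_good uQR sZ.
  have /h/(_ (phi_on_segment b tQ tR sZ))[] : phi b Z \in X' by rewrite XX'.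
    by move/(phi_inj (good_in_triangle gZ) tQ); left.
  by move/(phi_inj (good_in_triangle gZ) tR); right.
- by rewrite XX'.
- by rewrite XX'.
- by move/(phi_inj tQ tR).
- move=> Z ZX' /(phi_on_segment_inv tQ tR)[Y sY eZ]; subst Z.
  move: ZX'; rewrite XX'; last exact: upper_good sY.
  by move/h => /(_ sY)[] ->; [left|right].
Qed.

Lemma good_axis P : good P -> P.2 = 0 -> P \in calS 0.
Proof.
case: P => x y /andP[_ /= h] y0; rewrite y0 ltxx /= in h *.
by case/orP: h => /eqP->; rewrite !inE ?eqxx ?orbT.
Qed.

(** Either condition on the image forces height zero for [P], and a [good] point of height zero is a
    corner. *)
Lemma good_phi_side b P : good P -> (phi b P).2 = 0 \/ (phi b P).1 = 1 ->
  P \in calS 0.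
Proof.
move=> gP h; apply: good_axis => //; move: h.
case/andP: gP; case: P => x y /and3P[/= h1 h2 h3] _.
have d : 1 + y != 0 by rewrite gt_eqF //; lra.
case: b => /= -[] /(canRL (divfK d)); lra.
Qed.

(** The two images of the triangle meet only along the first cut, which [phi0] covers from the
    diagonal and [phi1] from the right side, with equal parameters. *)
Lemma phi_overlap P P' : in_triangle P -> in_triangle P' -> phi0 P = phi1 P' ->
  exists x, P = seg_pt diag x /\ P' = seg_pt right_side x.
Proof.
case: P P' => x y [x' y'] /and3P[/= h1 h2 h3] /and3P[/= k1 k2 k3].
have d : 1 + y != 0 by rewrite gt_eqF //; lra.
have d' : 1 + y' != 0 by rewrite gt_eqF //; lra.
case=> /eqP; rewrite eqr_div // => /eqP e1 /eqP; rewrite eqr_div // => /eqP e2.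
have l1 : y' <= y by nra.
have l2 : y <= y' by nra.
have e : y' = y by lra.
subst y'; exists y; rewrite /seg_pt /=.
split; congr pair; nra.
Qed.

(** A point of the first cut has two preimages on different sides; [calS_side] makes the choice
    between them immaterial. *)
Lemma phi_share k b c P P' : in_triangle P -> in_triangle P' ->
  phi b P = phi c P' -> P' \in calS k -> P \in calS k.
Proof.
move=> tP tP'; case: b c => [] [].
- by move/(phi_inj (b := true) tP tP') ->.
- by case/(phi_overlap tP tP') => x [-> ->]; exact: calS_side.
- by move/esym/(phi_overlap tP' tP) => [x [-> ->]]; exact: calS_side.
- by move/(phi_inj (b := false) tP tP') ->.
Qed.

Lemma segments1_sub k : {subset segments 1 <= segments k.+1}.
Proof. by elim: k => // k IH s /IH; exact: segments_sub. Qed.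

(** Cuts map to cuts. The right side and the diagonal map to the first cut or to a half of the
    diagonal, and such a half is only contained in a segment. *)
Lemma segments_phi_sub k b s : s \in segments k -> upper s ->
  exists2 s', s' \in segments k.+1 &
    forall Z, on_segment (seg_map b s) Z -> on_segment s' Z.
Proof.
move=> sk us; case: (segments_phi b sk) => [s0|]; last by exists (seg_map b s).
suff [s' s1 h] : exists2 s', s' \in segments 1 &
    forall Z, on_segment (seg_map b s) Z -> on_segment s' Z.
  by exists s' => //; exact: segments1_sub.
move: s0 us; rewrite !inE => /or3P[]/eqP-> // _.
- case: b.
    exists diag => // Z; apply: on_segment_trans.
      exact: (on_segment_right diag).
    by exists (1 / 2); split; [lra | apply/eqP; vm_compute].
  by exists (seg_map false right_side).
- case: b.
    by exists (seg_map false right_side).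
  exists diag => // Z; apply: on_segment_trans.
    by exists 0; split; [lra | apply/eqP; vm_compute].
  by exists (1 / 2); split; [lra | apply/eqP; vm_compute].
Qed.

(** * The first level *)

Definition roots : seq point := [:: (1 / 2, 0); (1, 1 / 2); (1 / 2, 1 / 2)].

Lemma calS1_cases P : P \in calS 1 -> P \in calS 0 \/ P \in roots.
Proof.
case/calS_cases => [|[s [Q [R [_ [Q0 R0 QR _] _ _ ->]]]]]; [by left|right].
move: Q0 R0 QR; rewrite !inE.
by case/orP=> [/orP[]|] /eqP-> /orP[/orP[]|] /eqP-> // _; vm_compute.
Qed.

Lemma half_calS1 : ((1 / 2, 1 / 2) : point) \in calS 1.
Proof.
rewrite (_ : (_, _) = mediant (0, 0) (1, 1)); last by apply/eqP; vm_compute.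
apply: (calS_mediant (s := diag)) => //;
  [|exact: (on_segment_left diag)|exact: (on_segment_right diag)].
split; [by rewrite !inE eqxx|by rewrite !inE eqxx ?orbT|by []|move=> Z].
rewrite !inE => /orP[/orP[]|] /eqP->; [by left| |by right].
by case=> t [ht []] /= e1 e2; exfalso; lra.
Qed.

Lemma roots_calS1 P : P \in roots -> P \in calS 1.
Proof.
(* The midpoint of the diagonal gives those of the other two sides. *)
have h s : s \in segments 0 -> seg_pt s (1 / 2) \in calS 1.
  move=> s0; apply: (@calS_side 1 diag s) => //.
  by rewrite (_ : seg_pt _ _ = (1 / 2, 1 / 2)) ?half_calS1 //; apply/eqP; vm_compute.
rewrite !inE => /or3P[]/eqP->.
- by rewrite (_ : (_, _) = seg_pt bottom (1 / 2)) ?h //; apply/eqP; vm_compute.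
- by rewrite (_ : (_, _) = seg_pt right_side (1 / 2)) ?h //; apply/eqP; vm_compute.
- exact: half_calS1.
Qed.

Lemma phi_calS_base b P : good P -> (phi b P \in calS 1) = (P \in calS 0).
Proof.
move=> gP; apply/idP/idP => [|P0].
  (* Cleared of denominators, an equation for [phi b P] is linear in the coordinates of [P]. *)
  have gen u v : (phi b P = (u, v)) ->
      if b then 1 = u * (1 + P.2) /\ P.1 = v * (1 + P.2)
      else P.1 = u * (1 + P.2) /\ P.2 = v * (1 + P.2).
    have d : 1 + P.2 != 0.
      by case/andP: gP => /and3P[_ _ h3] _; rewrite gt_eqF //; lra.
    by case: b => -[<- <-]; rewrite !divfK.
  case/andP: gP; case: P gen => x y /= gen /and3P[/= h1 h2 h3] h.
  move/calS1_cases; rewrite !inE => hb.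
  have {}hb : [\/ phi b (x, y) = (0, 0), phi b (x, y) = (1, 0)
                 | phi b (x, y) = (1, 1)] \/
      [\/ phi b (x, y) = (1 / 2, 0), phi b (x, y) = (1, 1 / 2)
       | phi b (x, y) = (1 / 2, 1 / 2)].
    by case: hb => [/orP[/orP[]|]|/or3P[]] /eqP;
      [left; constructor 1|left; constructor 2|left; constructor 3
      |right; constructor 1|right; constructor 2|right; constructor 3].
  (* The preimage of each of the six points is a corner, or no point of the triangle, or the
     midpoint [(1 / 2, 0)] of the bottom side, which is not [good]. *)
  case: hb => -[] /gen {gen}; case: b => -[e1 e2]; case/or3P: h => [h|/eqP h|/eqP h];
  first [ exfalso; lra
        | have -> : x = 0 by [lra]; have -> : y = 0 by [lra]; by rewrite ?eqxx ?orbT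
        | have -> : x = 1 by [lra]; have -> : y = 0 by [lra]; by rewrite ?eqxx ?orbT
        | have -> : x = 1 by [lra]; have -> : y = 1 by [lra]; by rewrite ?eqxx ?orbT ].
move: P0; rewrite !inE => /orP[/orP[]|] /eqP->; case: b;
  first [ by apply: corner_calS; rewrite !inE; vm_compute
        | by apply: roots_calS1; vm_compute ].
Qed.

Lemma conv_coef (a b z : rat) : a < z < b ->
  exists2 t : rat, 0 <= t <= 1 & z = (1 - t) * a + t * b.
Proof.
move=> /andP[az zb]; have d : 0 < b - a by lra.
exists ((z - a) / (b - a)); last by field; rewrite gt_eqF.
by rewrite divr_ge0 ?ler_pdivrMr //; lra.
Qed.

(** The midpoint of the diagonal is already present, so an adjacent pair cannot straddle it. The two
    halves are images of sides, which lets the pair be pulled back. *)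
Lemma adj_diag k Q R : adj (calS k.+1) Q R -> on_segment diag Q -> on_segment diag R ->
  (on_segment (seg_map false diag) Q /\ on_segment (seg_map false diag) R) \/
  (on_segment (seg_map true right_side) Q /\ on_segment (seg_map true right_side) R).
Proof.
move=> [QX RX _ h] [q [hq]]; rewrite -/(seg_pt diag q) => Qq.
case=> r [hr]; rewrite -/(seg_pt diag r) => Rr.
have lower z : 0 <= z <= 1 / 2 -> on_segment (seg_map false diag) (seg_pt diag z).
  move=> hz; rewrite (_ : seg_map _ _ = ((0, 0), (1 / 2, 1 / 2)));
    last by apply/eqP; vm_compute.
  by exists (2 * z); split; [lra | rewrite /seg_pt /=; congr pair; field].
have higher z : 1 / 2 <= z <= 1 -> on_segment (seg_map true right_side) (seg_pt diag z).
  move=> hz; rewrite (_ : seg_map _ _ = ((1, 1), (1 / 2, 1 / 2)));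
    last by apply/eqP; vm_compute.
  by exists (2 - 2 * z); split; [lra | rewrite /seg_pt /=; congr pair; field].
have half : seg_pt diag (1 / 2) \in calS k.+1.
  rewrite (_ : seg_pt _ _ = (1 / 2, 1 / 2)); last by apply/eqP; vm_compute.
  elim: (k) => [|j]; [exact: half_calS1 | exact: calS_sub].
have btw u v : u < 1 / 2 < v ->
    on_segment (seg_pt diag u, seg_pt diag v) (seg_pt diag (1 / 2)).
  by move=> huv; apply/seg_pt_on_segment => //; exact: conv_coef.
have inj := @seg_pt_side_inj diag isT.
subst Q R.
case: (leP q (1 / 2)) => hq2; case: (leP r (1 / 2)) => hr2.
- by left; split; apply: lower; lra.
- case: (eqVneq q (1 / 2)) => [e|ne].
    by right; split; apply: higher; lra.
  have hq3 : q < 1 / 2 by rewrite lt_neqAle ne hq2.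
  have : q < 1 / 2 < r by rewrite hq3.
  by move/btw/(h _ half) => [] /inj e; exfalso; lra.
- case: (eqVneq r (1 / 2)) => [e|ne].
    by right; split; apply: higher; lra.
  have hr3 : r < 1 / 2 by rewrite lt_neqAle ne hr2.
  have : r < 1 / 2 < q by rewrite hr3.
  by move/btw/on_segmentC/(h _ half) => [] /inj e; exfalso; lra.
- by right; split; apply: higher; lra.
Qed.

(** Both directions transport the adjacent pair behind a mediant. Going back, a segment that is not
    a side is itself an image; on the bottom or right side [P] must be a corner; on the diagonal the
    pair lies in one half. *)
Lemma phi_calS k b P : good P -> (phi b P \in calS k.+1) = (P \in calS k).
Proof.
elim: k b P => [|k IH] b P gP; first exact: phi_calS_base.
have tP := good_in_triangle gP.
apply/idP/idP => [/calS_cases[|[s [Q [R [sk a sQ sR e]]]]]|].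
- by rewrite IH // => /calS_sub.
(* The pair may have to be pulled back by the map other than [phi b], when the mediant lies on the
   first cut; [phi_share] then returns to [P]. *)
- have key c s' : s' \in segments k -> upper s' ->
      on_segment (seg_map c s') Q -> on_segment (seg_map c s') R -> P \in calS k.+1.
    move=> s'k us'; have [t1 t2] := upper_in_triangle us'.
    case/(phi_on_segment_inv t1 t2) => Q' sQ' eQ /(phi_on_segment_inv t1 t2)[R' sR' eR].
    rewrite -surjective_pairing in sQ' sR'; subst Q R.
    have QR' : Q' <> R' by case: a => _ _ ne _ eQR; apply: ne; rewrite eQR.
    have u := upper_sub us' sQ' sR' QR'.
    have [/= tQ' tR'] := upper_in_triangle u.
    move/(adj_phi (IH c) u): a => a; rewrite -phi_mediant // in e.
    have m := calS_mediant s'k a sQ' sR'.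
    exact: (phi_share tP (mediant_in_triangle tQ' tR') e m).
  case/segments_inv: sk => [s0|[c [s' [es s'k us']]]]; last first.
    by rewrite es in sQ sR; exact: key sQ sR.
  have sm := on_segment_trans sQ sR (mediant_on_segment Q R).
  rewrite -e in sm.
  move: s0 sQ sR sm; rewrite !inE => /or3P[]/eqP-> sQ sR sm.
  + case: sm => t [_ et]; apply/corner_calS/(@good_phi_side b P gP); left.
    by rewrite et /=; ring.
  + case: sm => t [_ et]; apply/corner_calS/(@good_phi_side b P gP); right.
    by rewrite et /=; ring.
  + case: (adj_diag a sQ sR) => -[]; apply: key.
    * exact: sides_sub.
    * exact: upper_diag.
    * exact: sides_sub.
    * exact: upper_right_side.
- have old : P \in calS k -> phi b P \in calS k.+2 by rewrite -(IH b) // => /calS_sub.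
  case/calS_cases => [//|[s [Q [R [sk a sQ sR e]]]]].
  case: (segments_upper sk) => [eb|us].
    (* A mediant taken on the bottom side has height zero, so a [good] one is a corner. *)
    apply/old/corner_calS/good_axis => //.
    have := on_segment_trans sQ sR (mediant_on_segment Q R).
    by rewrite -e eb => -[t [_ ->]] /=; ring.
  have QR : Q <> R by case: a.
  have u := upper_sub us sQ sR QR; have [/= tQ tR] := upper_in_triangle u.
  have [t1 t2] := upper_in_triangle us.
  have [s' s'k sub] := segments_phi_sub b sk us.
  rewrite e phi_mediant //; apply: (calS_mediant s'k).
  + exact/(adj_phi (IH b) u).
  + by apply: sub; apply: phi_on_segment => //; rewrite -surjective_pairing.
  + by apply: sub; apply: phi_on_segment => //; rewrite -surjective_pairing.
Qed.

(** * Comparison of the two trees *)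

Lemma phi_new k b P : good P ->
  (phi b P \in calS k.+2 `\` calS k.+1) = (P \in calS k.+1 `\` calS k).
Proof. by move=> gP; rewrite !in_fsetD !phi_calS. Qed.

Lemma new_side k s s' x : s \in segments 0 -> s' \in segments 0 ->
  seg_pt s x \in calS k.+1 `\` calS k -> seg_pt s' x \in calS k.+1 `\` calS k.
Proof.
move=> s0 s0'; rewrite !in_fsetD => /andP[nx xk].
rewrite (calS_side s0 s0' xk) andbT.
by apply: contra nx; exact: calS_side.
Qed.

Lemma good_pos P : in_triangle P -> P.2 != 0 -> good P.
Proof.
by move=> tP y0; rewrite /good tP lt_neqAle eq_sym y0; case/and3P: tP => _ _ ->.
Qed.

Lemma new_in_triangle k P : P \in calS k.+1 `\` calS k -> in_triangle P.
Proof. by rewrite in_fsetD => /andP[_ /calS_in_triangle]. Qed.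

Lemma new_not_corner k P : P \in calS k.+1 `\` calS k -> P \notin calS 0.
Proof. by rewrite in_fsetD => /andP[+ _]; apply: contra => /corner_calS. Qed.

(** At height zero such a point would be a corner, and corners are never new. This makes [phi_new]
    available for rules R2 and R4. *)
Lemma new_good k P : P \in calS k.+1 `\` calS k ->
  P.1 = P.2 \/ P.1 = 1 -> good P.
Proof.
move=> Pk h; have tP := new_in_triangle Pk.
apply: good_pos => //; apply: contraNneq (new_not_corner Pk) => y0.
apply: good_axis => //; rewrite /good tP /=.
by case: h => ->; rewrite ?y0 eqxx ?orbT.
Qed.

Lemma diagE P : P.1 = P.2 -> P = seg_pt diag P.2.
Proof. by case: P => x y /= ->; rewrite /seg_pt /=; congr pair; ring. Qed.

Lemma bottomE P : P.2 = 0 -> P = seg_pt bottom P.1.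
Proof. by case: P => x y /= ->; rewrite /seg_pt /=; congr pair; ring. Qed.

Lemma phi2_diag P : phi2 P = seg_pt bottom P.1.
Proof. by case: P => x y; rewrite /phi2 /seg_pt /=; congr pair; ring. Qed.

Lemma phi0_bottom P : P.2 = 0 -> phi0 P = seg_pt right_side P.1.
Proof. by case: P => x y /= ->; rewrite /phi0 /seg_pt /=; congr pair; field. Qed.

Lemma interior_good P : in_interior P -> good P.
Proof.
case/and3P=> h1 h2 h3; apply: good_pos; last by rewrite gt_eqF.
by apply/and3P; split; apply: ltW.
Qed.

Local Arguments calS : simpl never.

(** Rules that raise the level apply [phi0] or [phi1] to a [good] point. The same-level parts of R2
    and R3 carry a point from the diagonal to the bottom and from the bottom to the right side,
    keeping its parameter. *)
Lemma calT_new k P : calT k P ->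
  if k is j.+1 then P \in calS j.+1 `\` calS j else P \in calS 0.
Proof.
elim=> {k P} //= [P Pr|k P _ Pk /interior_good gP|k P _ Pk /interior_good gP
  |k P _ Pk _ d|k P _ Pk _ d|k P _ Pk _ y0|k P _ Pk _ x1|k P _ Pk _ x1].
- rewrite in_fsetD roots_calS1 // andbT.
  by move: Pr; rewrite !inE => /or3P[]/eqP->.
- by rewrite -[phi0 P]/(phi true P) phi_new.
- by rewrite -[phi1 P]/(phi false P) phi_new.
- by rewrite phi2_diag d; apply: (@new_side _ diag) => //; rewrite -diagE.
- by rewrite -[phi1 P]/(phi false P) (phi_new _ _ (new_good Pk (or_introl d))).
- by rewrite phi0_bottom //; apply: (@new_side _ bottom) => //; rewrite -bottomE.
- by rewrite -[phi0 P]/(phi true P) (phi_new _ _ (new_good Pk (or_intror x1))).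
- by rewrite -[phi1 P]/(phi false P) (phi_new _ _ (new_good Pk (or_intror x1))).
Qed.

Lemma phi_surj P : in_triangle P -> exists b Q, in_triangle Q /\ P = phi b Q.
Proof.
case: P => u v /and3P[/= h1 h2 h3].
(* The line of the first cut is [u + v = 1]; [phi1] covers the part below it and [phi0] the part
   above. *)
case: (lerP (u + v) 1) => h.
  have d : 0 < 1 - v by lra.
  have d0 : 1 - v != 0 by rewrite gt_eqF.
  exists false, (u / (1 - v), v / (1 - v)); split.
    by apply/and3P; split; rewrite /= ?divr_ge0 ?ler_pdivrMr ?divfK //; lra.
  by congr pair; rewrite /=; field; rewrite d0 subrK.
have d : 0 < u by lra.
have d0 : u != 0 by rewrite gt_eqF.
exists true, (v / u, (1 - u) / u); split.
  by apply/and3P; split; rewrite /= ?divr_ge0 ?ler_pdivrMr ?divfK //; lra.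
by congr pair; rewrite /=; field; rewrite d0 addrC subrK.
Qed.

Lemma boundary_cases P : in_triangle P -> ~~ in_interior P ->
  [\/ P.1 = P.2, P.1 = 1 | P.2 = 0].
Proof.
case/and3P => h1 h2 h3; rewrite /in_interior !negb_and -!leNgt => /or3P[] h.
- by constructor 2; lra.
- by constructor 1; lra.
- by constructor 3; lra.
Qed.

Lemma calT_of_phi n b Q : good Q ->
  (forall P, P \in calS n.+1 `\` calS n -> calT n.+1 P) ->
  phi b Q \in calS n.+2 `\` calS n.+1 -> calT n.+2 (phi b Q).
Proof.
move=> gQ IH; rewrite phi_new // => Qn.
have tQ := good_in_triangle gQ.
have TQ := IH Q Qn.
case: (boolP (in_interior Q)) => [iQ|nQ].
  by case: b; [exact: calT_R1_phi0 | exact: calT_R1_phi1].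
have bQ : in_boundary Q by rewrite /in_boundary tQ.
case: (boundary_cases tQ nQ) => h.
- case: b; last exact: calT_R2_phi1.
  (* No rule applies [phi0] to a diagonal point, but its image is also [phi1] of the point of the
     right side with the same parameter, which R4 generates. *)
  pose R := seg_pt right_side Q.2.
  have Rn : R \in calS n.+1 `\` calS n.
    by apply: (@new_side _ diag) => //; rewrite -diagE.
  have -> : phi true Q = phi1 R.
    rewrite /= /phi0 /phi1 /R /seg_pt /= h; congr pair; rewrite ?mulr0 ?mulr1 ?add0r //.
    by congr (_ / _); ring.
  have R1 : R.1 = 1 by rewrite /R /seg_pt /=; ring.
  apply: calT_R4_phi1; [exact: IH| |exact: R1].
  by rewrite /in_boundary (new_in_triangle Rn) /in_interior R1 ltxx.
- by case: b; [exact: calT_R4_phi0 | exact: calT_R4_phi1].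
- by have := new_not_corner Qn; rewrite good_axis.
Qed.

Lemma calT_sides k (P : point) : in_triangle P -> calT k.+1 (P.1, P.1) ->
  calT k.+1 (P.1, 0) /\ calT k.+1 (1, P.1).
Proof.
case: P => x y /and3P[/= h1 h2 h3] Tx.
have T0 : calT k.+1 (x, 0).
  apply: (calT_R2_phi2 Tx) => //; rewrite /in_boundary /in_interior /in_triangle /=.
  by rewrite ltxx andbF andbT h1 lexx; lra.
split=> //; rewrite (_ : (1, x) = phi0 (x, 0)).
  apply: (calT_R3_phi0 T0) => //; rewrite /in_boundary /in_interior /in_triangle /=.
  by rewrite ltxx !andbF andbT h1 lexx; lra.
by rewrite /phi0 /=; congr pair; field.
Qed.

Lemma new_calT n P : P \in calS n.+1 `\` calS n -> calT n.+1 P.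
Proof.
elim: n P => [|n IH] P Pn.
  move: Pn; rewrite in_fsetD => /andP[nP /calS1_cases[]]; first by rewrite (negPf nP).
  exact: calT_root.
have tP := new_in_triangle Pn.
have [b [Q [tQ e]]] := phi_surj tP.
case: (boolP (good Q)) => [gQ|nQ].
  by rewrite e in Pn *; exact: calT_of_phi.
have y0 : Q.2 = 0 by apply/eqP; apply: contraNT nQ; exact: good_pos.
(* With [Q] on the bottom side, [P] lies on the bottom or right side with parameter [Q.1]. The
   diagonal point with this parameter is new too; it is generated first, and R2 and R3 then lead
   back to [P]. *)
have side_new s : s \in segments 0 -> seg_pt s Q.1 \in calS n.+2 `\` calS n.+1.
  move=> s0; rewrite e in Pn; case: b {e} Pn => Pn.
    by apply: (@new_side _ right_side) => //; rewrite -phi0_bottom.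
  apply: (@new_side _ bottom) => //; rewrite -bottomE //.
  by move: Pn; case: (Q) y0 => x y /= ->; rewrite /phi1 /= addr0 !divr1.
have Dn := side_new diag isT.
have Td : calT n.+2 (Q.1, Q.1).
  have dE : seg_pt diag Q.1 = (Q.1, Q.1) by rewrite [RHS]diagE.
  rewrite -dE; have [c [R [tR eR]]] := phi_surj (new_in_triangle Dn).
  (* A preimage of height zero of a diagonal point can only be a corner, since its image is [(x, 0)]
     or [(1, x)]. *)
  have gR : good R.
    case: (eqVneq R.2 0) => [r0|]; last exact: good_pos.
    rewrite /good tR; rewrite dE in eR.
    case: R r0 eR {tR} => x y /= ->; case: c => -[]; rewrite addr0 !divr1.
      by move=> -> ->; rewrite eqxx !orbT.
    by move=> -> ->; rewrite eqxx !orbT.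
  by rewrite eR in Dn *; exact: calT_of_phi.
have [T0 T1] := calT_sides tQ Td.
rewrite e; case: (b).
  rewrite /= phi0_bottom //; rewrite (_ : seg_pt _ _ = (1, Q.1)) //.
  by rewrite /seg_pt /=; congr pair; ring.
rewrite (_ : phi _ _ = (Q.1, 0)) //.
by case: (Q) y0 => x y /= ->; rewrite /phi1 /= addr0 !divr1.
Qed.

Theorem theorem5p10 (n : nat) (P : point) :
  calT n.+1 P <-> P \in calS n.+1 `\` calS n.
Proof. by split=> [/calT_new|/new_calT]. Qed.
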